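(* For every prime $p>2$, $$\sum_{n=0}^{p-1}\frac{(\frac12)_n^3(\frac12)_{2n}}{n!^5}(120n^2+34n+3)\frac1{2^{6n}}\equiv3p^2\pmod{p^5};$$ equivalently (using $(\frac12)_{2n}=4^n(\frac14)_n(\frac34)_n$), $$\sum_{n=0}^{p-1}\frac{(\frac12)_n^3(\frac14)_n(\frac34)_n}{n!^5}(120n^2+34n+3)\frac1{2^{4n}}\equiv3p^2\pmod{p^5}.$$
   Context: $(a)_n=a(a+1)\cdots(a+n-1)=\Gamma(a+n)/\Gamma(a)$ denotes the Pochhammer symbol, with $(a)_0=1$. The sums are rational numbers with denominators coprime to $p$; congruences are understood in the ring of rationals with denominators coprime to $p$. *)

(* Defs.v *)
From HB Require Import structures.
From mathcomp Require Import all_boot all_order all_algebra.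

Set Implicit Arguments.
Unset Strict Implicit.
Unset Printing Implicit Defensive.

Import Order.TTheory GRing.Theory Num.Theory.
Local Open Scope ring_scope.

Definition pochhammer (a : rat) (n : nat) : rat :=
  \prod_(0 <= i < n) (a + i%:R).

Definition p_integral (p : nat) (x : rat) : bool := coprime `|denq x| p.

(* The congruence in the ring of p-integral rationals: the witness z must be
   p-integral, since over rat alone every x - y is a multiple of m != 0. *)
Definition p_integral_eqmod (p m : nat) (x y : rat) : Prop :=
  [/\ p_integral p x, p_integral p y
    & exists2 z : rat, p_integral p z & x - y = m%:R * z].

(* Main.v *)
Require Import Defs.
From HB Require Import structures.
From mathcomp Require Import all_boot all_order all_algebra.
From mathcomp Require Import zify ring lra.

Set Implicit Arguments.
Unset Strict Implicit.
Unset Printing Implicit Defensive.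

Import Order.TTheory GRing.Theory Num.Theory.
Local Open Scope ring_scope.

(** Write p = 2m + 1. The summand is [wzF n 0] for the WZ pair
    F(n,k) - F(n,k+1) = G(n+1,k) - G(n,k) below, so the sum over n < p equals
    the sum of the F(n,m) plus the G(p,k) with k < m. Counting factors p in the
    Pochhammer symbols, G(p,k) = 0 (mod p^5) for k < m and F(n,m) = 0 (mod p^5)
    for n <> m, so only F(m,m) survives. Reindexing (1/2)_(3m+1) and using
    2^(p-1) = prod_(j <= m) (1 - 2u_j) / (1 - u_j) with u_j = p / (2j) gives
      F(m,m) = 3 p^2 prod_j (1 - u_j^2) (1 - 3u_j) (1 - u_j)^3 / (1 - 2u_j)^3.
    Since (1 - 3u)(1 - u)^3 = (1 - 2u)^3 + O(u^3), the product is
    1 - p^2 sum_j 1/(2j)^2 modulo p^3, and 3 sum_j 1/(2j)^2 = 0 (mod p). The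
    factor 3 in front makes the argument uniform in p > 2, including p = 3. *)

(** * The ring of [p]-integral rationals and its multiples of powers of [p] *)

Definition pint (p : nat) : {pred rat} := p_integral p.

(** Any denominator coprime to [p] will do, so the ring operations may multiply denominators without
    reducing fractions. *)
Lemma pintP (p : nat) (x : rat) :
  reflect (exists2 d : nat, (0 < d)%N && coprime d p & x * d%:R \is a Num.int)
          (x \in pint p).
Proof.
apply: (iffP idP) => [copx | [d /andP[d_gt0 copd] /intrP[n xd]]].
  exists `|denq x|%N.
    by rewrite absz_gt0 denq_neq0.
  by rewrite pmulrn absz_denq -numqE intr_int.
apply: coprime_dvdl copd.
(* The reduced denominator is coprime to the numerator, so it divides [d] once it divides the
   numerator times [d]. *)
rewrite -(@Gauss_dvdr _ `|numq x|); last by rewrite coprime_sym coprime_num_den.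
apply/dvdnP; exists `|n|%N; rewrite -[d in LHS]absz_nat -!abszM; congr absz.
apply/(@intr_inj rat); rewrite !rmorphM /= -xd numqE -pmulrn.
by rewrite mulrAC.
Qed.

Fact pint_subring_closed p : subring_closed (pint p).
Proof.
split=> [|x y|x y]; first by apply/pintP; exists 1%N; rewrite ?coprime1n ?mulr1.
- move=> /pintP[d /andP[d0 cod] xd] /pintP[e /andP[e0 coe] ye].
  apply/pintP; exists (d * e)%N; first by rewrite muln_gt0 d0 e0 coprimeMl cod.
  have -> : (x - y) * (d * e)%:R = x * d%:R * e%:R - y * e%:R * d%:R by ring.
  by rewrite rpredB // rpredM // rpred_nat.
move=> /pintP[d /andP[d0 cod] xd] /pintP[e /andP[e0 coe] ye].
apply/pintP; exists (d * e)%N; first by rewrite muln_gt0 d0 e0 coprimeMl cod.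
have -> : (x * y) * (d * e)%:R = (x * d%:R) * (y * e%:R) by ring.
exact: rpredM.
Qed.
HB.instance Definition _ p :=
  GRing.isSubringClosed.Build rat (pint p) (pint_subring_closed p).

Lemma pint_invn p n : (0 < n)%N -> coprime n p -> n%:R^-1 \in pint p.
Proof.
move=> n0 con; apply/pintP; exists n; first by rewrite n0.
by rewrite mulVf ?pnatr_eq0 -?lt0n.
Qed.

Lemma pint_invn_lt p n : prime p -> (0 < n < p)%N -> n%:R^-1 \in pint p.
Proof.
move=> p_pr /andP[n0 np]; apply: pint_invn => //.
by rewrite coprime_sym prime_coprime // gtnNdvd.
Qed.

Lemma pint_inv_fact p n : prime p -> (n < p)%N -> n`!%:R^-1 \in pint p.
Proof.
move=> p_pr; elim: n => [|n IHn] np; first by rewrite invr1 rpred1.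
by rewrite factS natrM invfM rpredM ?IHn ?pint_invn_lt // ltnW.
Qed.

(* Multiples of p ^ k in the ring of p-integral rationals (for p > 0). *)
Definition pmult (p k : nat) : {pred rat} := [pred x | x / p%:R ^+ k \in pint p].

Fact pmult_zmod_closed p k : zmod_closed (pmult p k).
Proof.
split=> [|x y]; rewrite !inE; first by rewrite mul0r rpred0.
by move=> xk yk; rewrite mulrBl rpredB.
Qed.
HB.instance Definition _ p k :=
  GRing.isZmodClosed.Build rat (pmult p k) (pmult_zmod_closed p k).

Lemma pmult0 p x : (x \in pmult p 0) = (x \in pint p).
Proof. by rewrite inE expr0 divr1. Qed.

Lemma pmultM p k l x y : x \in pmult p k -> y \in pmult p l ->
  x * y \in pmult p (k + l).
Proof. by rewrite !inE exprD invfM mulrACA; apply: rpredM. Qed.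

Lemma pmultMl p k x y : x \in pint p -> y \in pmult p k -> x * y \in pmult p k.
Proof. by rewrite -pmult0; apply: pmultM. Qed.

Lemma pmultMr p k x y : x \in pmult p k -> y \in pint p -> x * y \in pmult p k.
Proof. by rewrite mulrC => xk yp; apply: pmultMl. Qed.

Lemma pmultX p k n x : x \in pmult p k -> x ^+ n \in pmult p (k * n).
Proof. by rewrite !inE exprM -expr_div_n; apply: rpredX. Qed.

Lemma pmultXn p k : prime p -> p%:R ^+ k \in pmult p k.
Proof.
move=> /prime_gt0 p0.
by rewrite inE divff ?rpred1 // expf_neq0 // pnatr_eq0 -lt0n.
Qed.

Lemma pmult_weak p k l x : prime p -> (l <= k)%N ->
  x \in pmult p k -> x \in pmult p l.
Proof.
move=> /prime_gt0 p0 lk xk; rewrite inE.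
have -> : x / p%:R ^+ l = x / p%:R ^+ k * p%:R ^+ (k - l).
  have -> : p%:R ^+ k = p%:R ^+ (k - l) * p%:R ^+ l :> rat by rewrite -exprD subnK.
  by field; rewrite !expf_neq0 // pnatr_eq0 -lt0n.
by rewrite rpredM // rpredX // rpred_nat.
Qed.

Lemma pmult_pint p k x : prime p -> x \in pmult p k -> x \in pint p.
Proof. by rewrite -pmult0 => p_pr; apply: pmult_weak. Qed.

Lemma eqmod_pmult p k x y : prime p -> y \in pint p -> x - y \in pmult p k ->
  p_integral_eqmod p (p ^ k) x y.
Proof.
move=> p_pr yp xy; have xp : x \in pint p.
  by rewrite -[x](subrK y) rpredD //; apply: pmult_pint xy.
split=> //.
exists ((x - y) / p%:R ^+ k); first exact: xy.
by rewrite natrX mulrC divfK // expf_neq0 // pnatr_eq0 -lt0n prime_gt0.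
Qed.

(** Products of two of the [a i] are multiples of p^4, so only the linear part of the expanded
    product survives modulo p^3. *)
Lemma prod1D_pmult p m (f a : nat -> rat) : prime p ->
    (forall i, (i < m)%N -> a i \in pmult p 2) ->
    (forall i, (i < m)%N -> f i - (1 + a i) \in pmult p 3) ->
  \prod_(0 <= i < m) f i - (1 + \sum_(0 <= i < m) a i) \in pmult p 3.
Proof.
move=> p_pr; elim: m => [|m IHm] am fm; first by rewrite !big_geq // addr0 subrr rpred0.
rewrite !big_nat_recr //=.
set P := \prod_(_ <= _ < _) _ in IHm *; set S := \sum_(_ <= _ < _) _ in IHm *.
have S2 : S \in pmult p 2.
  by rewrite /S big_nat rpred_sum // => i /andP[_ im]; apply: am; apply: ltnW.
have {IHm} PS : P - (1 + S) \in pmult p 3.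
  by apply: IHm => i im; [apply: am | apply: fm]; apply: ltnW.
have am2 := am m (ltnSn m); have fm3 := fm m (ltnSn m).
have -> : P * f m - (1 + (S + a m)) =
  (P - (1 + S)) * f m + (1 + S) * (f m - (1 + a m)) + S * a m by ring.
have inp k x : x \in pmult p k -> x \in pint p by apply: pmult_pint.
have ap : 1 + a m \in pint p by rewrite rpredD ?rpred1 //; apply: inp am2.
rewrite !rpredD //.
- apply: pmultMr => //; rewrite -[f m](subrK (1 + a m)).
  by apply: rpredD => //; apply: inp fm3.
- by apply: pmultMl => //; rewrite rpredD ?rpred1 //; exact: inp S2.
by apply: (@pmult_weak _ 4) => //; exact: (pmultM S2 am2).
Qed.

(** * Pochhammer symbols *)

Lemma pochhammerS a n : pochhammer a n.+1 = pochhammer a n * (a + n%:R).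
Proof. by rewrite /pochhammer big_nat_recr. Qed.

Lemma pochhammerD a m n :
  pochhammer a (m + n) = pochhammer a m * pochhammer (a + m%:R) n.
Proof.
elim: n => [|n IHn]; first by rewrite addn0 /pochhammer [in X in _ * X]big_geq // mulr1.
by rewrite addnS !pochhammerS IHn natrD; ring.
Qed.

Lemma pochhammer_rev a n :
  pochhammer a n = \prod_(0 <= i < n) (a + (n - i.+1)%:R).
Proof. by rewrite /pochhammer big_nat_rev. Qed.

Lemma half_addn_neq0 n : 1 / 2 + n%:R != 0 :> rat.
Proof. by apply: lt0r_neq0; have := ler0n rat n; lra. Qed.

Lemma pochhammer_half_neq0 n : pochhammer (1 / 2) n != 0.
Proof.
elim: n => [|n IHn]; first by rewrite /pochhammer big_geq ?oner_neq0.
by rewrite pochhammerS; apply: mulf_neq0 IHn (half_addn_neq0 n).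
Qed.

Lemma pochhammer_half_double n :
  pochhammer (1 / 2) (2 * n) =
  4 ^+ n * pochhammer (1 / 4) n * pochhammer (3 / 4) n.
Proof.
elim: n => [|n IHn]; first by rewrite /pochhammer !big_geq.
have -> : (2 * n.+1 = (2 * n).+2)%N by lia.
rewrite !pochhammerS IHn exprS -[(2 * n).+1]addn1 natrD natrM.
by field.
Qed.

(** * The WZ pair and the resulting summation formula *)

(* The falling factorial n ^_ k = n! / (n - k)! makes wz_base n k vanish for
   n < k, so that the WZ identity below needs no side condition. *)
Definition wz_base (n k : nat) : rat :=
  pochhammer (1 / 2) n ^+ 3 * pochhammer (1 / 2) (2 * n + k)
  * (n ^_ k)%:R ^+ 2 / (64 ^+ n * n`!%:R ^+ 5).

Definition wzF (n k : nat) : rat :=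
  (120 * n%:R ^+ 2 - 84 * n%:R * k%:R + 34 * n%:R - 10 * k%:R + 3)
  * wz_base n k / pochhammer (1 / 2) k ^+ 3.

(** The factor n^3 (n - k)^2 clears the denominator of the ratio of [wz_base] at n and n - 1, and
    the n^3 makes [wzG] vanish at n = 0. *)
Definition wzG (n k : nat) : rat :=
  256 * n%:R ^+ 3 * (n%:R - k%:R) ^+ 2
  * wz_base n k / pochhammer (1 / 2) k.+1 ^+ 3.

Lemma ffactSr n k : (n ^_ k.+1)%:R = (n ^_ k)%:R * (n%:R - k%:R) :> rat.
Proof.
rewrite ffactnSr natrM; case: (leqP k n) => [kn | nk]; first by rewrite natrB.
by rewrite ffact_small // !mul0r.
Qed.

Lemma wz_baseSr n k :
  wz_base n k.+1 = (1 / 2 + (2 * n + k)%:R) * (n%:R - k%:R) ^+ 2 * wz_base n k.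
Proof. by rewrite /wz_base addnS pochhammerS ffactSr; ring. Qed.

(** In this cleared form the recurrence also covers k > n, where both sides are 0. *)
Lemma wz_baseSl n k :
  (n.+1%:R - k%:R) ^+ 2 * n.+1%:R ^+ 3 * wz_base n.+1 k =
  (1 / 2 + n%:R) ^+ 3 * (1 / 2 + (2 * n + k)%:R) * (1 / 2 + (2 * n + k).+1%:R)
  * wz_base n k / 64.
Proof.
rewrite /wz_base (_ : (2 * n.+1 + k = (2 * n + k).+2)%N); last by lia.
rewrite !pochhammerS factS natrM.
(* Two expansions of (n+1)^_(k+1) give (n+1) n^_k = (n+1)^_k (n+1-k). *)
have := ffactSr n.+1 k; rewrite ffactSS natrM => ff.
rewrite [LHS](_ : _ = n.+1%:R ^+ 3 * ((n.+1 ^_ k)%:R * (n.+1%:R - k%:R)) ^+ 2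
  * ((pochhammer (1 / 2) n * (1 / 2 + n%:R)) ^+ 3
     * (pochhammer (1 / 2) (2 * n + k) * (1 / 2 + (2 * n + k)%:R)
        * (1 / 2 + (2 * n + k).+1%:R)))
  / (64 ^+ n.+1 * (n.+1%:R * n`!%:R) ^+ 5)); last by ring.
rewrite -ff [64 ^+ n.+1]exprS; field.
by rewrite nat1r !pnatr_eq0 -lt0n fact_gt0 expf_neq0.
Qed.

(** All four terms are rational multiples of [wz_base n k], so a rational function identity in n and
    k remains. *)
Lemma wz_pair n k : wzF n k - wzF n k.+1 = wzG n.+1 k - wzG n k.
Proof.
have -> : wzG n.+1 k = 256 * ((n.+1%:R - k%:R) ^+ 2 * n.+1%:R ^+ 3 * wz_base n.+1 k)
    / pochhammer (1 / 2) k.+1 ^+ 3 by rewrite /wzG; ring.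
rewrite /wzF /wzG wz_baseSl wz_baseSr pochhammerS.
rewrite -[(2 * n + k).+1]addn1 -[k.+1]addn1 !(natrD, natrM).
have := pochhammer_half_neq0 k; have := half_addn_neq0 k.
move: (pochhammer _ k) (wz_base n k) n%:R k%:R => h w N K k0 h0.
field; rewrite h0 andbT.
have -> : 1 + K * 2 = 2 * (1 / 2 + K) by field.
by rewrite mulf_neq0.
Qed.

Lemma wzG0 k : wzG 0 k = 0.
Proof. by rewrite /wzG expr0n /= mulr0 !mul0r. Qed.

(** Raising K by one changes the sum of the [wzF n K] by a sum telescoping in n, whose lower end is
    [wzG 0 K] = 0. *)
Lemma wzF_sum N K :
  \sum_(0 <= n < N) wzF n 0 =
  \sum_(0 <= n < N) wzF n K + \sum_(0 <= k < K) wzG N k.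
Proof.
elim: K => [|K IHK]; first by rewrite [X in _ + X]big_geq ?addr0.
rewrite IHK big_nat_recr //= addrA addrAC; congr (_ + _); apply/eqP.
rewrite addrC -subr_eq -sumrB; apply/eqP.
under eq_bigr do rewrite wz_pair.
by rewrite (telescope_sumr (fun n => wzG n K)) // wzG0 subr0.
Qed.

(** * Powers of [p] dividing the terms of the WZ pair *)

Lemma pint_half p : prime p -> (2 < p)%N -> 1 / 2 \in pint p.
Proof. by move=> p_pr p2; rewrite mul1r pint_invn_lt. Qed.

Lemma pint_pochhammer p a n : a \in pint p -> pochhammer a n \in pint p.
Proof. by move=> ap; rewrite rpred_prod // => i _; rewrite rpredD ?rpred_nat. Qed.

Lemma pochhammer_pmult p k l a m n : prime p -> a \in pint p -> (m < n)%N ->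
  pochhammer a m \in pmult p k -> a + m%:R \in pmult p l ->
  pochhammer a n \in pmult p (k + l).
Proof.
move=> p_pr ap mn mk ml; rewrite -(subnKC mn) pochhammerD pochhammerS.
by rewrite pmultMr ?pmultM ?pint_pochhammer // rpredD // rpred_nat.
Qed.

Lemma pmult1_half_muln p c : prime p -> (2 < p)%N -> (c * p)%:R / 2 \in pmult p 1.
Proof.
move=> p_pr p2; have := pmultXn 1 p_pr; rewrite expr1 => pp.
have -> : (c * p)%:R / 2 = (c%:R * (1 / 2)) * p%:R :> rat by rewrite natrM; field.
by rewrite pmultMl // rpredM ?pint_half ?rpred_nat.
Qed.

Lemma natr_doubleS n : n.*2.+1%:R = 2 * n%:R + 1 :> rat.
Proof. by rewrite -natr1 -mul2n natrM. Qed.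

Section OddPrime.

Variables p m : nat.
Hypotheses (p_pr : prime p) (p_gt2 : (2 < p)%N) (def_p : p = m.*2.+1).

Let pE : p%:R = 2 * m%:R + 1 :> rat.
Proof. by rewrite def_p natr_doubleS. Qed.

Let half_p : 1 / 2 \in pint p := pint_half p_pr p_gt2.

Lemma pochhammer_half_pmult1 n : (m < n)%N -> pochhammer (1 / 2) n \in pmult p 1.
Proof.
move=> mn; apply: (@pochhammer_pmult _ 0 1 _ m) => //.
  by rewrite pmult0 pint_pochhammer.
have -> : 1 / 2 + m%:R = (1 * p)%:R / 2 :> rat by rewrite mul1n pE; field.
exact: pmult1_half_muln.
Qed.

Lemma pochhammer_half_pmult2 n : (m + p < n)%N ->
  pochhammer (1 / 2) n \in pmult p 2.
Proof.
move=> mn; apply: (@pochhammer_pmult _ 1 1 _ (m + p)) => //.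
  by rewrite pochhammer_half_pmult1 //; lia.
have -> : 1 / 2 + (m + p)%:R = (3 * p)%:R / 2 :> rat.
  by rewrite natrM natrD pE; field.
exact: pmult1_half_muln.
Qed.

(** The factors are (2i+1)/2 with 2i+1 < p, hence units. *)
Lemma pint_inv_pochhammer_half k : (k <= m)%N ->
  (pochhammer (1 / 2) k)^-1 \in pint p.
Proof.
elim: k => [|k IHk] km; first by rewrite /pochhammer big_geq // invr1 rpred1.
rewrite pochhammerS invfM rpredM ?IHk 1?ltnW //.
have -> : (1 / 2 + k%:R)^-1 = 2 * (k.*2.+1)%:R^-1 :> rat.
  rewrite natr_doubleS; field.
  have k_ge0 := ler0n rat k; rewrite !lt0r_neq0 //; lra.
by rewrite rpredM ?rpred_nat // pint_invn_lt //; lia.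
Qed.

Lemma pint_inv_64X n : (64 ^+ n)^-1 \in pint p.
Proof.
rewrite -exprVn rpredX //.
have -> : 64^-1 = (1 / 2) ^+ 6 :> rat by field.
exact: rpredX.
Qed.

(** (1/2)_n contains p/2, which is cubed; (1/2)_(2n+m) contains p/2 and 3p/2, as 2n+m > m+p = 3m+1.
    The denominators are units. *)
Lemma wz_base_pmult5 n : (m < n < p)%N -> wz_base n m \in pmult p 5.
Proof.
move=> /andP[mn np]; rewrite /wz_base invfM.
apply: pmultMr; last by rewrite rpredM ?pint_inv_64X // -exprVn rpredX ?pint_inv_fact.
apply: pmultMr; last by rewrite rpredX ?rpred_nat.
apply: (@pmultM p 3 2); first by apply: (@pmultX p 1 3); apply: pochhammer_half_pmult1.
by apply: pochhammer_half_pmult2; lia.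
Qed.

Lemma wzF_pmult5 n : (n < p)%N -> n != m -> wzF n m \in pmult p 5.
Proof.
rewrite neq_ltn /wzF => np /orP[nm|mn].
  by rewrite /wz_base ffact_small // expr0n /= !(mulr0, mul0r) rpred0.
apply: pmultMr; last by rewrite -exprVn rpredX // pint_inv_pochhammer_half.
apply: pmultMl; last by rewrite wz_base_pmult5 // mn.
have natp c : c%:R \in pint p by apply: rpred_nat.
have n2 : n%:R ^+ 2 \in pint p by apply: rpredX.
have cM c x : x \in pint p -> c%:R * x \in pint p by apply: rpredM.
have nm : 84 * n%:R * m%:R \in pint p := rpredM (cM 84 _ (natp n)) (natp m).
exact: rpredD (rpredB (rpredD (rpredB (cM 120 _ n2) nm) (cM 34 _ (natp n)))
  (cM 10 _ (natp m))) (natp 3).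
Qed.

(** The p^5 in p!^5 cancels against p^3 and the square of p^_k (p-k) = p!/(p-k-1)!. Then (1/2)_p^3
    supplies p^3 and (1/2)_(2p+k) supplies p^2. *)
Lemma wzG_pmult5 k : (k < m)%N -> wzG p k \in pmult p 5.
Proof.
move=> km; have kp : (k.+1 <= p)%N by lia.
have fE : p`! = (p * p.-1`!)%N
  by rewrite -[p in LHS]prednK ?prime_gt0 // factS prednK ?prime_gt0.
have ffE : (p ^_ k)%:R * (p%:R - k%:R) = p`!%:R / (p - k.+1)`!%:R :> rat.
  by rewrite -ffactSr -(ffact_fact kp) natrM mulfK // pnatr_eq0 -lt0n fact_gt0.
have -> : wzG p k = pochhammer (1 / 2) p ^+ 3 * pochhammer (1 / 2) (2 * p + k)
    * (256 * ((p - k.+1)`!%:R^-1) ^+ 2 * (p.-1`!%:R^-1) ^+ 3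
       * (64 ^+ p)^-1 * (pochhammer (1 / 2) k.+1)^-1 ^+ 3).
  rewrite /wzG /wz_base.
  rewrite [LHS](_ : _ = 256 * p%:R ^+ 3 * ((p ^_ k)%:R * (p%:R - k%:R)) ^+ 2
     * (pochhammer (1 / 2) p ^+ 3 * pochhammer (1 / 2) (2 * p + k)
        / (64 ^+ p * p`!%:R ^+ 5)) / pochhammer (1 / 2) k.+1 ^+ 3); last by ring.
  rewrite ffE fE natrM; field.
  by rewrite pochhammer_half_neq0 !pnatr_eq0 -!lt0n !fact_gt0 expf_neq0 // prime_gt0.
apply: pmultMr; last first.
  have f1 : (p - k.+1)`!%:R^-1 \in pint p by rewrite pint_inv_fact //; lia.
  have f2 : p.-1`!%:R^-1 \in pint p by rewrite pint_inv_fact //; lia.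
  exact: rpredM (rpredM (rpredM (rpredM (rpred_nat _ 256) (rpredX 2 f1))
    (rpredX 3 f2)) (pint_inv_64X p)) (rpredX 3 (pint_inv_pochhammer_half km)).
apply: (@pmultM p 3 2).
  by apply: (@pmultX p 1 3); apply: pochhammer_half_pmult1; lia.
by apply: pochhammer_half_pmult2; lia.
Qed.

Lemma wz_sum_eqmod : \sum_(0 <= n < p) wzF n 0 - wzF m m \in pmult p 5.
Proof.
have mp : (m < p)%N by lia.
rewrite (wzF_sum p m) (bigD1_seq m) ?mem_index_iota ?iota_uniq //=.
rewrite addrAC [wzF m m + _]addrC addrK; apply: rpredD; last first.
  by rewrite big_nat rpred_sum // => k /andP[_ km]; apply: wzG_pmult5.
rewrite big_nat_cond rpred_sum // => n /andP[/andP[_ np] nm].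
exact: wzF_pmult5.
Qed.

End OddPrime.

(** * Pairing i with p - i *)

(** With p = 2m+1 the second index is p - 2(i+1): the odd numbers are the complements of the even
    ones. The operation is generic because both products and sums are paired this way. *)
Lemma big_pair_parity (R : Type) (idx : R) (op : Monoid.com_law idx) (f : nat -> R) m :
  \big[op/idx]_(1 <= i < m.*2.+1) f i =
  \big[op/idx]_(0 <= i < m) op (f i.+1.*2) (f (m.*2 - i.*2.+1)%N).
Proof.
rewrite big_split /= [X in op _ X]big_nat_rev /= -big_split /=.
transitivity (\big[op/idx]_(0 <= i < m) op (f i.+1.*2) (f i.*2.+1)).
  elim: m => [|m IHm]; first by rewrite !big_geq.
  rewrite doubleS big_nat_recr // big_nat_recr // IHm [RHS]big_nat_recr //=.
  by rewrite -Monoid.mulmA; congr (op _ _); rewrite Monoid.mulmC.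
apply: eq_big_nat => i im; congr (op _ (f _)); lia.
Qed.

Lemma big_pair_rev (R : Type) (idx : R) (op : Monoid.com_law idx) (f : nat -> R) m :
  \big[op/idx]_(1 <= i < m.*2.+1) f i =
  \big[op/idx]_(0 <= i < m) op (f i.+1) (f (m.*2 - i)%N).
Proof.
rewrite (@big_cat_nat _ _ _ m.+1) //=; last by lia.
rewrite [X in op _ X]big_nat_rev /= big_split; congr (op _ _); first by rewrite big_add1.
rewrite -{1}[m.+1]add0n big_addn; have -> : (m.*2.+1 - m.+1 = m)%N by lia.
apply: eq_big_nat => i im; congr f; lia.
Qed.

(** * The surviving term F(m,m) *)

Section LastTerm.

Variables p m : nat.
Hypothesis def_p : p = m.*2.+1.

Let pE : p%:R = 2 * m%:R + 1 :> rat.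
Proof. by rewrite def_p natr_doubleS. Qed.

(* Indices are shifted: u i is the u_(i+1) of the header. *)
Let u (i : nat) : rat := p%:R / (2 * i.+1%:R).

Lemma natr_p_sub i : (i < m)%N -> (m.*2 - i)%:R = p%:R - i.+1%:R :> rat.
Proof. by move=> im; rewrite -natrB def_p 1?subSS //; lia. Qed.

Lemma natr_p_sub2 i : (i < m)%N -> (m.*2 - i.*2.+1)%:R = p%:R - 2 * i.+1%:R :> rat.
Proof. by move=> im; rewrite -natrM -natrB def_p; [congr (_%:R) |]; lia. Qed.

Lemma u_compl2E i : (i < m)%N -> 1 - 2 * u i = - (m.*2 - i)%:R / i.+1%:R.
Proof.
move=> im; have i0 : i.+1%:R != 0 :> rat by rewrite pnatr_eq0.
by rewrite natr_p_sub // /u; move: i.+1%:R i0 => x x0; field.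
Qed.

Lemma u_unit i : (i < m)%N -> (1 - u i != 0) && (1 - 2 * u i != 0).
Proof.
move=> im; have i0 : i.+1%:R != 0 :> rat by rewrite pnatr_eq0.
have -> : 1 - u i = - (m.*2 - i.*2.+1)%:R / (2 * i.+1%:R).
  by rewrite natr_p_sub2 // /u; move: i.+1%:R i0 => x x0; field.
rewrite u_compl2E //.
by rewrite !mulf_neq0 ?oppr_eq0 ?invr_eq0 ?mulf_neq0 ?pnatr_eq0 //; lia.
Qed.

(** Pairing (p-1)! in two ways gives prod 2j(p-2j) = prod j(p-j), where j = i+1. Since p = 2ju, the
    factors are -4j^2(1-u) and -j^2(1-2u). *)
Lemma pow4_prod : 4 ^+ m = \prod_(0 <= i < m) ((1 - 2 * u i) / (1 - u i)).
Proof.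
have eqP : \prod_(0 <= i < m) (i.+1.*2%:R * (m.*2 - i.*2.+1)%:R)
         = \prod_(0 <= i < m) (i.+1%:R * (m.*2 - i)%:R) :> rat.
  by rewrite -(big_pair_parity *%R (fun i => i%:R : rat)) (big_pair_rev *%R).
have P0 : \prod_(0 <= i < m) (i.+1.*2%:R * (m.*2 - i.*2.+1)%:R) != 0 :> rat.
  rewrite prodf_seq_neq0; apply/allP => i; rewrite mem_index_iota => im /=.
  by rewrite mulf_neq0 // pnatr_eq0; lia.
apply: (mulIf P0); rewrite -[RHS]big_split /=.
have -> : 4 ^+ m = \prod_(0 <= i < m) 4 :> rat by rewrite prodr_const_nat subn0.
rewrite [in LHS]eqP -[LHS]big_split /=.
rewrite big_nat [RHS]big_nat.
apply: eq_bigr => i /andP[_ im].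
have /andP[u1 u2] := u_unit im.
rewrite natr_p_sub // natr_p_sub2 // -mul2n natrM.
have i0 : i.+1%:R != 0 :> rat by rewrite pnatr_eq0.
have pu : p%:R = 2 * i.+1%:R * u i by rewrite /u; move: i.+1%:R i0 => x x0; field.
by rewrite pu; move: i.+1%:R (u i) u1 {i0 pu u2} => x y y1; field.
Qed.

(** The indices 0..3m split into m, the central index m, m and m. With the outer blocks reversed,
    their factors are (p-2j)/2, p/2, (p+2j)/2 and (3p-2j)/2 for j = i+1. *)
Lemma pochhammer_half_prod :
  pochhammer (1 / 2) (3 * m).+1 =
  p%:R / 2 * \prod_(0 <= i < m)
    ((p%:R - 2 * i.+1%:R) * (p%:R + 2 * i.+1%:R) * (3 * p%:R - 2 * i.+1%:R) / 8).
Proof.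
have -> : ((3 * m).+1 = m.+1 + m + m)%N by lia.
rewrite !pochhammerD pochhammerS.
rewrite pochhammer_rev [pochhammer _ m in X in _ * X]pochhammer_rev.
have -> : 1 / 2 + m%:R = p%:R / 2 :> rat by rewrite pE; field.
have comb (a b c d : rat) : a * d * b * c = d * (a * b * c) by ring.
rewrite comb /pochhammer -!big_split /=; congr (_ * _).
rewrite big_nat [RHS]big_nat; apply: eq_bigr => i /andP[_ im].
rewrite natrB // -[m.+1]addn1 -[i.+1]addn1 !natrD pE.
by field.
Qed.

Lemma wzF_diag : wzF m m = 3 * p%:R ^+ 2 *
  \prod_(0 <= i < m)
    ((1 - u i ^+ 2) * (1 - 3 * u i) * (1 - u i) ^+ 3 / (1 - 2 * u i) ^+ 3).
Proof.
have f0 : m`!%:R != 0 :> rat by rewrite pnatr_eq0 -lt0n fact_gt0.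
(* At n = k = m the polynomial is 36m^2+24m+3 = 3(2m+1)(6m+1); here 2m+1 = p, and (6m+1)/2 extends
   (1/2)_(3m) to (1/2)_(3m+1). *)
have -> : wzF m m =
    6 * p%:R * pochhammer (1 / 2) (3 * m).+1 / ((4 ^+ m) ^+ 3 * m`!%:R ^+ 3).
  rewrite /wzF /wz_base pochhammerS ffactnn -exprM [(m * 3)%N]mulnC exprM.
  have -> : (2 * m + m = 3 * m)%N by lia.
  rewrite pE natrM (_ : 4 ^+ 3 = 64 :> rat); last by ring.
  have := pochhammer_half_neq0 m; have : 64 ^+ m != 0 :> rat by rewrite expf_neq0.
  move: (64 ^+ m) (pochhammer _ m) m`!%:R f0 => s h f f0 s0 h0.
  by field; rewrite s0 f0 h0.
rewrite pow4_prod fact_prod natr_prod big_add1 /= pochhammer_half_prod.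
rewrite -!prodrXl -big_split /= -prodfV.
have comb (x a b : rat) : 6 * x * (x / 2 * a) * b = 3 * x ^+ 2 * (a * b) by field.
rewrite comb -big_split /=; congr (_ * _).
rewrite big_nat [RHS]big_nat; apply: eq_bigr => i /andP[_ im].
have /andP[u1 u2] := u_unit im.
have i0 : i.+1%:R != 0 :> rat by rewrite pnatr_eq0.
have pu : p%:R = 2 * i.+1%:R * u i by rewrite /u; move: i.+1%:R i0 => x x0; field.
rewrite pu; move: i.+1%:R (u i) i0 u1 u2 {pu} => x y x0 y1 y2.
by field; rewrite x0 y1 y2.
Qed.

Hypotheses (p_pr : prime p) (p_gt2 : (2 < p)%N).

Let r (i : nat) : rat := (i.+1.*2)%:R^-1.

Lemma pint_r i : (i < m)%N -> r i \in pint p.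
Proof. by move=> im; rewrite /r pint_invn_lt //; lia. Qed.

Lemma uE i : u i = p%:R * r i.
Proof. by rewrite /u /r -mul2n natrM. Qed.

Lemma pmult_p : p%:R \in pmult p 1.
Proof. by have := pmultXn 1 p_pr; rewrite expr1. Qed.

Lemma pmult_u i : (i < m)%N -> u i \in pmult p 1.
Proof. by move=> im; rewrite uE; apply: pmultMr pmult_p (pint_r im). Qed.

Lemma pint_inv_compl2 i : (i < m)%N -> (1 - 2 * u i)^-1 \in pint p.
Proof.
move=> im; rewrite u_compl2E // invfM invrK invrN mulNr rpredN.
by apply: rpredM (rpred_nat _ _); rewrite pint_invn_lt //; lia.
Qed.

Lemma diag_factor_eqmod i : (i < m)%N ->
  (1 - u i ^+ 2) * (1 - 3 * u i) * (1 - u i) ^+ 3 / (1 - 2 * u i) ^+ 3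
  - (1 + - u i ^+ 2) \in pmult p 3.
Proof.
move=> im; have /andP[_ u2] := u_unit im.
(* Exactly, (1-3u)(1-u)^3 - (1-2u)^3 = u^3 (3u-2). *)
have -> : (1 - u i ^+ 2) * (1 - 3 * u i) * (1 - u i) ^+ 3 / (1 - 2 * u i) ^+ 3
    - (1 + - u i ^+ 2)
  = u i ^+ 3 * ((1 - u i ^+ 2) * (3 * u i - 2) * (1 - 2 * u i)^-1 ^+ 3).
  by move: (u i) u2 => x x2; field.
have up : u i \in pint p := pmult_pint p_pr (pmult_u im).
apply: pmultMr (pmultX 3 (pmult_u im)) _.
apply: rpredM (rpredX 3 (pint_inv_compl2 im)).
exact: rpredM (rpredB (rpred1 _) (rpredX 2 up))
  (rpredB (rpredM (rpred_nat _ 3) up) (rpred_nat _ 2)).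
Qed.

Lemma inv_sqr_compl_eqmod x : (0 < x < p)%N ->
  (p - x)%:R^-1 ^+ 2 - x%:R^-1 ^+ 2 \in pmult p 1.
Proof.
move=> xp; have x0 : x%:R != 0 :> rat by rewrite pnatr_eq0; lia.
have px0 : (p - x)%:R != 0 :> rat by rewrite pnatr_eq0; lia.
have ix : x%:R^-1 \in pint p by rewrite pint_invn_lt.
have ipx : (p - x)%:R^-1 \in pint p by rewrite pint_invn_lt //; lia.
have E : p%:R = (p - x)%:R + x%:R :> rat by rewrite -natrD subnK //; lia.
have -> : (p - x)%:R^-1 ^+ 2 - x%:R^-1 ^+ 2 =
    p%:R * ((x%:R - (p - x)%:R) * x%:R^-1 ^+ 2 * (p - x)%:R^-1 ^+ 2) :> rat.
  by rewrite E; move: (p - x)%:R x%:R px0 x0 => y z y0 z0; field; rewrite y0 z0.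
apply: pmultMr pmult_p _.
exact: rpredM (rpredM (rpredB (rpred_nat _ _) (rpred_nat _ _)) (rpredX 2 ix))
  (rpredX 2 ipx).
Qed.

(* Pairing i with p - i in the sum of 1/i^2 over 0 < i < p, with i running either
   over the even numbers or over 1, ..., m, yields 2S = 8S (mod p). *)
Lemma sum_inv_sqr_pmult1 : 3 * \sum_(0 <= i < m) r i ^+ 2 \in pmult p 1.
Proof.
pose f i : rat := i%:R^-1 ^+ 2.
have E : \sum_(0 <= i < m) (f i.+1.*2 + f (m.*2 - i.*2.+1)%N) =
         \sum_(0 <= i < m) (f i.+1 + f (m.*2 - i)%N).
  by rewrite -(big_pair_parity +%R) -(big_pair_rev +%R).
(* With S the sum of the [r i ^+ 2] and A, B the sums over the complements, [E] reads S + A = 4S +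
   B, so (A - S) - (B - 4S) = 6S. *)
have D : 6 * \sum_(0 <= i < m) r i ^+ 2 =
   \sum_(0 <= i < m) (f (m.*2 - i.*2.+1)%N - f i.+1.*2)
   - \sum_(0 <= i < m) (f (m.*2 - i)%N - f i.+1).
  have f4 : \sum_(0 <= i < m) f i.+1 = 4 * \sum_(0 <= i < m) r i ^+ 2.
    rewrite mulr_sumr; apply: eq_bigr => i _; rewrite /f /r -mul2n natrM.
    have : i.+1%:R != 0 :> rat by rewrite pnatr_eq0.
    by move: i.+1%:R => x x0; field.
  move: E; rewrite !sumrB !big_split /= f4.
  have -> : \sum_(0 <= i < m) f i.+1.*2 = \sum_(0 <= i < m) r i ^+ 2 by [].
  by move=> E; lra.
have -> : 3 * \sum_(0 <= i < m) r i ^+ 2 = 1 / 2 * (6 * \sum_(0 <= i < m) r i ^+ 2).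
  by field.
apply: pmultMl (pint_half p_pr p_gt2) _; rewrite D.
apply: rpredB; rewrite big_nat rpred_sum // => i /andP[_ im]; rewrite /f.
  have -> : (m.*2 - i.*2.+1 = p - i.+1.*2)%N by lia.
  by apply: inv_sqr_compl_eqmod; lia.
have -> : (m.*2 - i = p - i.+1)%N by lia.
by apply: inv_sqr_compl_eqmod; lia.
Qed.

Lemma wzF_diag_eqmod : wzF m m - 3 * p%:R ^+ 2 \in pmult p 5.
Proof.
rewrite wzF_diag; set P := \prod_(_ <= _ < _) _.
have PE : P - (1 + \sum_(0 <= i < m) - u i ^+ 2) \in pmult p 3.
  apply: prod1D_pmult => // i im; last exact: diag_factor_eqmod.
  by rewrite rpredN; apply: (@pmultX p 1 2); apply: pmult_u.
have SE : \sum_(0 <= i < m) - u i ^+ 2 = - (p%:R ^+ 2 * \sum_(0 <= i < m) r i ^+ 2).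
  by rewrite sumrN mulr_sumr; congr (- _); apply: eq_bigr => i _; rewrite uE exprMn.
(* The 3 stays with the sum of the [r i ^+ 2]: for p = 3 that sum is 1/4, not itself a multiple of
   p. *)
have -> : 3 * p%:R ^+ 2 * P - 3 * p%:R ^+ 2 =
    3 * (p%:R ^+ 2 * (P - (1 + \sum_(0 <= i < m) - u i ^+ 2)))
    - p%:R ^+ 4 * (3 * \sum_(0 <= i < m) r i ^+ 2).
  by rewrite SE; ring.
apply: rpredB; last exact: pmultM (pmultXn 4 p_pr) sum_inv_sqr_pmult1.
by apply: pmultMl; [exact: rpred_nat | exact: pmultM (pmultXn 2 p_pr) PE].
Qed.

End LastTerm.

(** * The two forms of the summand and the theorem *)

Lemma summandE (n : nat) :
  pochhammer (1 / 2) n ^+ 3 * pochhammer (1 / 2) (2 * n) / n`!%:R ^+ 5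
       * (120 * n%:R ^+ 2 + 34 * n%:R + 3) * (1 / 2 ^+ (6 * n)) = wzF n 0.
Proof.
rewrite /wzF /wz_base exprM (_ : 2 ^+ 6 = 64 :> rat); last by ring.
rewrite addn0 ffactn0 [pochhammer _ 0]big_geq //.
have n0 : 64 ^+ n != 0 :> rat by rewrite expf_neq0.
have f0 : n`!%:R != 0 :> rat by rewrite pnatr_eq0 -lt0n fact_gt0.
by field; rewrite n0 f0.
Qed.

Lemma summand_quarterE (n : nat) :
  pochhammer (1 / 2) n ^+ 3 * pochhammer (1 / 4) n * pochhammer (3 / 4) n
       / n`!%:R ^+ 5
       * (120 * n%:R ^+ 2 + 34 * n%:R + 3) * (1 / 2 ^+ (4 * n)) = wzF n 0.
Proof.
rewrite -summandE.
have -> : 2 ^+ (6 * n) = 4 ^+ n * 2 ^+ (4 * n) :> rat.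
  by rewrite -[6%N]/(2 + 4)%N mulnDl exprD exprM; congr (_ ^+ _ * _); ring.
have n0 : 4 ^+ n != 0 :> rat by rewrite expf_neq0.
have t0 : 2 ^+ (4 * n) != 0 :> rat by rewrite expf_neq0.
have f0 : n`!%:R != 0 :> rat by rewrite pnatr_eq0 -lt0n fact_gt0.
rewrite pochhammer_half_double; move: (4 ^+ n) (2 ^+ (4 * n)) n0 t0 => x y x0 y0.
by field; rewrite x0 y0 f0.
Qed.

Theorem theorem2 (p : nat) (p_prime : prime p) (p_gt2 : (2 < p)%N) :
  p_integral_eqmod p (p ^ 5)
    (\sum_(0 <= n < p)
       pochhammer (1 / 2) n ^+ 3 * pochhammer (1 / 2) (2 * n) / n`!%:R ^+ 5
       * (120 * n%:R ^+ 2 + 34 * n%:R + 3) * (1 / 2 ^+ (6 * n)))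
    (3 * p%:R ^+ 2)
  /\
  p_integral_eqmod p (p ^ 5)
    (\sum_(0 <= n < p)
       pochhammer (1 / 2) n ^+ 3 * pochhammer (1 / 4) n * pochhammer (3 / 4) n
       / n`!%:R ^+ 5
       * (120 * n%:R ^+ 2 + 34 * n%:R + 3) * (1 / 2 ^+ (4 * n)))
    (3 * p%:R ^+ 2).
Proof.
suff sum_eqmod : p_integral_eqmod p (p ^ 5) (\sum_(0 <= n < p) wzF n 0) (3 * p%:R ^+ 2).
  by split; [under eq_bigr do rewrite summandE
            | under eq_bigr do rewrite summand_quarterE].
have def_p : p = p./2.*2.+1.
  have /even_prime[p2|odd_p] := p_prime; first by rewrite p2 in p_gt2.
  by rewrite -[LHS]odd_double_half odd_p.
apply: eqmod_pmult => //.
  exact: rpredM (rpred_nat _ 3) (rpredX 2 (rpred_nat _ p)).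
rewrite -(subrKA (wzF p./2 p./2)).
by apply: rpredD; [exact: wz_sum_eqmod | exact: wzF_diag_eqmod].
Qed.
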